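(* Let $G=(V,E)$ be a connected graph such that \[\max\{\mathrm{dist}_{\mathrm{even}}(v):v\in V\}\le d_2+1.\] Then $G$ is traceable if any of the following conditions holds: (1) $\mathrm{diam}(G)\le 2$; (2) $|V(G)|\le 2d_2+2$; (3) $|V(G)|=2d_2+3$ and $G$ is 2-connected; or (4) $G$ is not 2-connected.
   Context: All graphs are finite, simple, undirected and nontrivial (at least two vertices). For a graph $G$ with $n=|V(G)|$, let $d_1\le d_2\le\dots\le d_n$ denote the degrees of its vertices in nondecreasing order (with multiplicity), so $d_2$ is the second smallest degree. For $v\in V(G)$, $\mathrm{dist}_{\mathrm{even}}(v)$ is the number of vertices $w\in V(G)$ such that the graph distance $\mathrm{dist}(v,w)$ is even; $v$ itself is counted, since $\mathrm{dist}(v,v)=0$. $\mathrm{diam}(G)$ is the diameter. A graph is traceable if it has a Hamiltonian path. A graph is 2-connected if it has more than 2 vertices and remains connected after deletion of any single vertex (and is connected), i.e. its vertex-connectivity is at least 2. *)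

(* Defs.v *)
(* A simple graph is a symmetric irreflexive relation e on a finType T of
   vertices. *)
From mathcomp Require Import all_boot.

Set Implicit Arguments.
Unset Strict Implicit.
Unset Printing Implicit Defensive.

Section Graph.

Variables (T : finType) (e : rel T).

Definition degree (v : T) : nat := #|[set w | e v w]|.

Definition degree_seq : seq nat := sort leq [seq degree v | v <- enum T].

(* Sequences are indexed from 0, so this is d_2 in d_1 <= d_2 <= ... <= d_n;
   the default 0 is only reached when #|T| < 2. *)
Definition second_degree : nat := nth 0 degree_seq 1.

(* There is a path with k edges from u to v. *)
Definition has_path (u v : T) (k : nat) : bool :=
  [exists p : k.-tuple T, [&& path e u p, uniq (u :: p) & last u p == v]].

(* The length of a shortest path from u to v: a path has fewer than #|T| edges,
   and `find` returns the least k < #|T| for which one exists.  The value is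
   #|T| when v is not reachable from u. *)
Definition dist (u v : T) : nat := find (has_path u v) (iota 0 #|T|).

Definition dist_even (v : T) : nat := #|[set w | ~~ odd (dist v w)]|.

(* Meaningful for connected graphs only, as `dist` is. *)
Definition diam : nat := \max_(u : T) \max_(v : T) dist u v.

Definition connected : Prop := forall x y : T, connect e x y.

(* `connect` on the relation restricted to the vertices other than v is
   reachability in the graph obtained by deleting v. *)
Definition two_connected : Prop :=
  [/\ 2 < #|T|,
      connected
    & forall v : T, {in predC1 v &, forall x y : T,
        connect [rel a b in predC1 v | e a b] x y}].

Definition traceable : Prop :=
  exists p : seq T, [/\ sorted e p, uniq p & forall v : T, v \in p].

End Graph.

(* Main.v *)
Require Import Defs.
From mathcomp Require Import all_boot.
From mathcomp Require Import zify.

Set Implicit Arguments.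
Unset Strict Implicit.
Unset Printing Implicit Defensive.

(** Write k for the second smallest degree and n for the number of vertices: all
    vertices but possibly one, x, have degree at least k, and every vertex has
    at most k + 1 vertices at even distance.  The hypothesis is used through
    the vertices that are far from v: at odd distance at least 3.  Since v has
    at most k + 1 vertices at even distance, at least n - k - 1 - deg v vertices
    are far from it ([card_far]).

    Take a path s from h to l that passes through x and cannot be enlarged: no
    path visits all its vertices and one more.  Posa's rotations let us assume
    that h and l have degree at least k, unless x has degree 1 and k > 1; as x
    is on s, every vertex z missed by s has degree at least k.  By maximality the
    successors on s of the neighbours of l are neither neighbours of z nor far
    from l.  If moreover neither z nor h nor any neighbour of z is far from l,
    then these successors, the vertices far from l, the neighbours of z and
    {z, h} are pairwise disjoint, and counting them gives deg z < k, which is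
    absurd ([far_contradiction]).

    If n <= 2k + 3, this extra condition can be met.  Call gaps the vertices of
    s other than h that are neither adjacent to h nor the successor of a
    neighbour of l; there are |s| - 1 - deg h - deg l of them, so at most one.
    A neighbour of z on s that is not adjacent to l is followed by a gap, and
    one that is not adjacent to h is a gap; z is never adjacent to two
    consecutive vertices.  So one end of s, say l after reversing s, is adjacent
    to all neighbours of z on s ([maximal_spans]).  Moreover a missed vertex has
    a neighbour on s adjacent to both ends as soon as its degree exceeds
    n - 2k - 2 ([missing_good_nbr]).  This settles n <= 2k + 2, and n = 2k + 3
    when all degrees are at least 2.  When the diameter is at most 2, no vertex
    is far from another, so deg h + deg l >= n - 1 and s misses nothing, as in
    Ore's theorem.

    If the removal of v leaves parts A and B, it suffices to find, for each
    part, a path from v that spans it ([separation_path]).  A path from v in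
    v + A that misses z in A has k successors of neighbours of its end, none of
    them adjacent to z, so |A| >= 2k.  Parity forces the opposite inequality:
    distances between A and B add up at v, so that v, and a neighbour of v in
    the other part, bound the numbers of vertices of A at even and at odd
    distance from v by k.  In the extreme case |A| = 2k a second count, of the
    vertices far from z, leaves no room for B.  A vertex x of degree 1 with
    k > 1, the case set aside above, is itself one side of a separation. *)

Section Simple.

Variables (T : finType) (e : rel T).
Hypotheses (e_sym : symmetric e) (e_irr : irreflexive e).

Let N (v : T) := [set w | e v w].
Let n := #|T|.

(** * Degrees *)

Lemma disjoint_notin (A B : {set T}) :
  (forall y, y \in A -> y \notin B) -> [disjoint A & B].
Proof. by move=> AB; rewrite disjoint_subset; apply/subsetP => y /AB. Qed.

Lemma seq_set (s : seq T) : uniq s -> {S : {set T} | S =i s & #|S| = size s}.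
Proof.
move=> us; exists [set y in s] => [y|]; first by rewrite inE.
by rewrite cardsE; apply/card_uniqP.
Qed.

(** At most one entry of the sorted degree sequence is below the second one. *)
Lemma second_degreeP :
  2 <= n -> exists x, forall u, u != x -> second_degree e <= degree e u.
Proof.
move=> n2; set d := second_degree e.
have le1: #|[set w | degree e w < d]| <= 1.
  have ->: #|[set w | degree e w < d]| = count (fun y => y < d) (degree_seq e).
    rewrite /degree_seq (permP (permEl (perm_sort _ _))) count_map cardE.
    rewrite enumT {1}/enum_mem size_filter; apply: eq_count => w /=;
      by rewrite inE.
  have: sorted leq (degree_seq e) by apply/sort_sorted/leq_total.
  have: 1 < size (degree_seq e) by rewrite size_sort size_map -cardT.
  rewrite /d /second_degree; case: (degree_seq e) => [|a [|b t]] //= _ /andP[_].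
  move=> /(order_path_min leq_trans)/allP bt.
  rewrite ltnn (@eq_in_count _ _ pred0) ?count_pred0; first by case: (_ < _).
  by move=> y /bt; rewrite leqNgt => /negbTE.
have /card_gt0P[x0 _]: 0 < #|T| by apply: ltnW.
have [x lx|l0] := pickP (fun w => degree e w < d).
  exists x => u /negP ux; rewrite leqNgt; apply/negP => lu; apply: ux.
  have /card_le1P/(_ x) := le1.
  by rewrite inE lx => /(_ isT u); rewrite !inE lu => <-.
by exists x0 => u _; rewrite leqNgt l0.
Qed.

Lemma degree_gt0 v : connected e -> 2 <= n -> 0 < degree e v.
Proof.
move=> cn n2.
have [w wv]: exists w, w != v.
  have: 0 < #|predC1 v| by rewrite cardC1; lia.
  by case/card_gt0P=> w; exists w.
have /connectP[[|a p] /=] := cn v w; first by move=> _ E; rewrite E eqxx in wv.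
by case/andP=> va _ _; apply/card_gt0P; exists a; rewrite inE.
Qed.

(** * Distances *)

(** Distances are defined by duplicate-free paths, but walks bound them too,
    once shortened. *)
Lemma dist_le u p : path e u p -> dist e u (last u p) <= size p.
Proof.
case/shortenP=> q pq Uq sub.
have qp: size q <= size p.
  by have /andP[_ uq] := Uq; apply: uniq_leq_size uq _ => y; apply: sub.
apply: leq_trans qp.
have sq: size q < #|T| by rewrite -[_.+1]/(size (u :: q)) -(card_uniqP Uq)
  max_card.
rewrite leqNgt; apply/negP => /(before_find 0) /negbT /negP; apply.
rewrite nth_iota // add0n; apply/existsP; exists (in_tuple q) => /=.
by rewrite pq eqxx andbT.
Qed.

Hypothesis e_conn : connected e.

Lemma dist_path u w :
  exists p, [/\ path e u p, last u p = w & size p = dist e u w].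
Proof.
have /connectP[p0 p0p ->] := e_conn u w.
case/shortenP: p0p => q pq Uq _.
have sq: size q < #|T| by rewrite -[_.+1]/(size (u :: q)) -(card_uniqP Uq)
  max_card.
have hs: has (has_path e u (last u q)) (iota 0 #|T|).
  apply/hasP; exists (size q); first by rewrite mem_iota.
  by apply/existsP; exists (in_tuple q) => /=; rewrite pq eqxx andbT.
have := nth_find 0 hs; move: (hs); rewrite has_find size_iota => lt.
rewrite nth_iota // add0n => /existsP[p /and3P[pp _ /eqP lp]].
by exists p; split; rewrite ?size_tuple.
Qed.

Lemma odd_dist_le2 u w : odd (dist e u w) -> dist e u w <= 2 -> e u w.
Proof.
have [p [+ + <-]] := dist_path u w.
by case: p => [|a [|b [|c p]]] //= /andP[ua _] <-.
Qed.

Lemma odd_dist_edge u w : e u w -> odd (dist e u w).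
Proof.
move=> uw; have /dist_le : path e u [:: w] by rewrite /= uw.
have [p [_ + <-]] := dist_path u w.
by case: p => [|a [|b p]] //= E; rewrite -E e_irr in uw.
Qed.

(** A vertex two steps away from u has distance at most 2, so an odd distance
    can only be 1. *)
Lemma odd_dist_step2 u a w : odd (dist e u w) -> e u a -> e a w -> e u w.
Proof.
move=> o ua aw; apply: odd_dist_le2 => //.
by have /dist_le : path e u [:: a; w] by rewrite /= ua aw.
Qed.

Let far (v : T) := [set w | odd (dist e v w) & ~~ e v w].

(** This turns the bound on vertices at even distance into a supply of far
    vertices. *)
Lemma card_far v : #|far v| + degree e v + dist_even e v = n.
Proof.
rewrite -[n](cardsC [set w | odd (dist e v w)]) /dist_even; congr addn;
  last first.
  by apply: eq_card => w; rewrite !inE.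
rewrite addnC -(cardsID (N v) [set w | odd (dist e v w)]); congr addn;
  apply: eq_card => w; rewrite !inE.
  by case vw: (e v w); rewrite ?andbF // odd_dist_edge.
by rewrite andbC.
Qed.

(** * Simple paths as lists *)

(** Unlike [path e h p], this form keeps the first vertex in the list and names
    both ends, so that a path can be reversed and cut anywhere. *)
Definition simple_path h s l :=
  [&& sorted e s, uniq s, ohead s == Some h & last h s == l].

Lemma sorted_revE s : sorted e (rev s) = sorted e s.
Proof. by rewrite rev_sorted; apply: eq_sorted => x y; rewrite e_sym. Qed.

Lemma sorted_catE a b s1 s2 :
  sorted e (rcons s1 a ++ b :: s2) =
  [&& sorted e (rcons s1 a), e a b & sorted e (b :: s2)].
Proof.
case: s1 => [|c s1] /=; first by [].
by rewrite cat_path last_rcons /=.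
Qed.

Lemma simple_path_rev h s l : simple_path h s l -> simple_path l (rev s) h.
Proof.
case/and4P=> ss us; rewrite /simple_path sorted_revE ss rev_uniq us /=.
case: s {ss us} => // c p; rewrite -[ohead _]/(Some c) => /eqP[->] /= /eqP <-.
by rewrite {2}rev_cons last_rcons eqxx andbT lastI rev_rcons.
Qed.

Lemma simple_path_mem h s l : simple_path h s l -> (h \in s) && (l \in s).
Proof.
case/and4P=> _ _; case: s => // c p.
rewrite -[ohead _]/(Some c) => /eqP[->] /= /eqP <-.
by rewrite mem_head mem_last.
Qed.

Lemma next_cat (s1 s2 : seq T) a b :
  uniq (s1 ++ a :: b :: s2) -> next (s1 ++ a :: b :: s2) a = b.
Proof.
move=> U; have aN: a \notin s1.
  by move: U; rewrite cat_uniq /= => /and3P[_ /norP[]].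
rewrite next_nth mem_cat mem_head orbT.
have ->: index a (s1 ++ a :: b :: s2) = size s1.
  by rewrite index_cat (negbTE aN) /= eqxx addn0.
case: s1 {U aN} => [|c s1] //=.
by rewrite nth_cat ltnNge leqnSn /= subSnn.
Qed.

(** The cyclic successor [next s] is the genuine successor on the path, except
    at the last vertex; it is used because it is injective on all vertices. *)
Lemma simple_path_split h s l a : simple_path h s l -> a \in s -> a != l ->
  exists s1 s2, s = rcons s1 a ++ next s a :: s2.
Proof.
case/and4P=> _ + _ + /splitPr sa; case: sa => s1 [|b s2] U.
  by rewrite last_cat /= => /eqP->; rewrite eqxx.
by move=> _ _; exists s1, s2; rewrite next_cat // cat_rcons.
Qed.

Lemma ohead_cat (s1 s2 s3 : seq T) a :
  ohead (rcons s1 a ++ s2) = ohead (rcons s1 a ++ s3).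
Proof. by case: s1. Qed.

Lemma next_edge h s l a :
  simple_path h s l -> a \in s -> a != l -> e a (next s a).
Proof.
move=> hs as_ al; have [s1 [s2 E]] := simple_path_split hs as_ al.
by have /and4P[+ _ _ _] := hs; rewrite {1}E sorted_catE => /and3P[].
Qed.

Lemma next_head h s l a :
  simple_path h s l -> a \in s -> a != l -> next s a != h.
Proof.
move=> hs as_ al; apply/negP => /eqP hE.
have [s1 [s2]] := simple_path_split hs as_ al; rewrite hE => E.
case/and4P: hs => _ + + _; rewrite E cat_uniq => /and3P[_ /hasPn /= h1 _].
have := h1 h (mem_head _ _); case: (s1) => [|c q]; rewrite inE.
  by move=> /negP + /eqP[ah]; apply; rewrite ah.
by move=> /norP[/negP + _] /eqP[ah]; apply; rewrite ah.
Qed.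

(** Posa's rotation: the edge from the end l back to a replaces the edge from a
    to its successor, which becomes the new end. *)
Lemma simple_path_pivot h s l a : simple_path h s l -> e l a -> a \in s ->
  exists s', perm_eq s' s /\ simple_path h s' (next s a).
Proof.
move=> hs la as_; have al: a != l by apply: contraTneq la => ->; rewrite e_irr.
have [s1 [s2 E]] := simple_path_split hs as_ al.
case/and4P: hs; rewrite {1 3}E sorted_catE (ohead_cat _ _ (rev (next s a ::
  s2))).
set b := next s a in E * => /and3P[sd1 ab sd2] us hd.
rewrite E last_cat /= => /eqP lE; exists (rcons s1 a ++ rev (b :: s2)).
have pe: perm_eq (rcons s1 a ++ rev (b :: s2)) s.
  by rewrite E perm_cat2l perm_rev.
split; first by rewrite -E.
apply/and4P; split=> //.
- have rE: rev (b :: s2) = l :: rev (belast b s2).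
    by rewrite lastI rev_rcons lE.
  by rewrite rE sorted_catE -rE sorted_revE sd1 e_sym la.
- by rewrite (perm_uniq pe) us.
by rewrite rev_cons -rcons_cat last_rcons.
Qed.

Lemma simple_path_rcons h s l z :
  simple_path h s l -> z \notin s -> e l z -> simple_path h (rcons s z) z.
Proof.
case/and4P; case: s => // c p ss us.
rewrite -[ohead _]/(Some c) => /eqP[<-] /= /eqP lE zs lz.
apply/and4P; split=> //=; last by rewrite last_rcons.
  by rewrite rcons_path; move: ss => /= ->; rewrite lE.
by have := rcons_uniq (c :: p) z; rewrite zs us => /= ->.
Qed.

(** The new path goes from z to a, back along s to h, and jumps from h to the
    successor of a. *)
Lemma simple_path_splice h s l z a :
    simple_path h s l -> z \notin s -> e z a -> a \in s -> a != l ->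
    e h (next s a) ->
  exists s', perm_eq s' (z :: s) /\ simple_path z s' l.
Proof.
move=> hs zs za as_ al.
have [s1 [s2]] := simple_path_split hs as_ al; set b := next s a => E hb.
have pe: perm_eq (z :: rev (rcons s1 a) ++ b :: s2) (z :: s).
  by rewrite perm_cons [X in perm_eq _ X]E perm_cat2r perm_rev.
exists (z :: rev (rcons s1 a) ++ b :: s2); split=> //.
case/and4P: hs => ss us hd lE.
apply/and4P; split=> //; last first.
- by move: lE; rewrite {1}E /= !last_cat /=.
- by rewrite (perm_uniq pe) /= zs us.
move: ss hd; rewrite {1 2}E sorted_catE => /and3P[s1a _ s2b].
case R: (rcons s1 a) => [|c q]; first by case: (s1) R.
rewrite -[ohead _]/(Some c) => /eqP[ch]; rewrite rev_cons -cat_cons -rcons_cons.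
rewrite sorted_catE s2b ch hb !andbT rcons_cons -ch -rev_cons -R.
move: s1a; rewrite -sorted_revE rev_rcons /= => ->.
by rewrite za.
Qed.

Lemma simple_path_insert h s l z a :
    simple_path h s l -> z \notin s -> e z a -> a \in s -> a != l ->
    e z (next s a) ->
  exists s', perm_eq s' (z :: s) /\ simple_path h s' l.
Proof.
move=> hs zs za as_ al.
have [s1 [s2]] := simple_path_split hs as_ al; set b := next s a => E zb.
have pe: perm_eq (rcons s1 a ++ z :: b :: s2) (z :: s).
  by rewrite -cat1s -[z :: s]cat1s [X in perm_eq _ (_ ++ X)]E perm_catCA.
exists (rcons s1 a ++ z :: b :: s2); split=> //.
case/and4P: hs => ss us hd lE.
apply/and4P; split=> //; last first.
- by move: lE; rewrite {1}E /= !last_cat /=.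
- by rewrite (ohead_cat _ _ (b :: s2)) -E.
- by rewrite (perm_uniq pe) /= zs us.
move: ss; rewrite {1}E !sorted_catE => /and3P[-> _ s2b].
by rewrite e_sym za /= zb.
Qed.

Lemma edge_out (S : pred T) x y :
  S x -> ~~ S y -> exists a b, [/\ S a, ~~ S b & e a b].
Proof.
have /connectP[p + ->] := e_conn x y.
elim: p x => [|b p IH] x /= => [_ ->//|/andP[xb bp] Sx Sl].
by have [Sb|Sb] := boolP (S b); [apply: IH bp Sb Sl | exists x, b].
Qed.

(** * Rotations of paths that cannot be enlarged *)

(** Only one extra vertex is tested, which is what all the constructions below
    would add; keeping the old vertices makes the notion stable under rotation
    and compatible with prescribing a vertex of the path. *)
Definition maximal s := forall h' s' l' z,
  z \notin s -> simple_path h' s' l' -> ~ perm_eq s' (z :: s).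

(** The variant for paths whose first vertex h is fixed and for one given
    vertex z to be added. *)
Definition stuck h s z := forall s' l', simple_path h s' l' ->
  ~ perm_eq s' (z :: s).

(** Otherwise the vertices of s form a cycle; since the graph is connected,
    some vertex outside it has a neighbour on it, and opening the cycle there
    gives a longer path. *)
Lemma maximal_open h s l z :
  simple_path h s l -> maximal s -> z \notin s -> ~~ e l h.
Proof.
move=> hs mx zs; apply/negP => lh.
have /andP[hins _] := simple_path_mem hs.
have [c [z' [cs zs' cz]]] := @edge_out (fun y => y \in s) _ _ hins zs.
case/and4P: hs => ss us hd lE.
have cyc: cycle e s.
  case: s ss hd lE {us mx zs hins cs zs'} => // d p.
  by rewrite -[ohead _]/(Some d) /= rcons_path => -> /eqP[->] /eqP->.
have [i s'' rE] := rot_to cs.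
have pe: perm_eq (z' :: c :: s'') (z' :: s) by rewrite perm_cons -rE perm_rot.
apply: (mx z' (z' :: c :: s'') (last c s'') z') pe => //.
apply/and4P; split=> //=; last first.
  by move: us; rewrite -(rot_uniq i) rE /= => ->; rewrite -rE mem_rot zs'.
by move: cyc; rewrite -(rot_cycle i) rE /= rcons_path => /andP[-> _];
  rewrite e_sym cz.
Qed.

(** The ends that one rotation at l can produce. *)
Definition succs s l := [set next s a | a in N l].

Lemma card_succs s l : uniq s -> #|succs s l| = degree e l.
Proof. by move=> us; apply/card_imset/can_inj/prev_next. Qed.

Lemma succs_sub s l : {subset N l <= s} -> {subset succs s l <= s}.
Proof. by move=> sub _ /imsetP[a /sub as_ ->]; rewrite mem_next. Qed.

Lemma head_succs h s l : simple_path h s l -> {subset N l <= s} ->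
  h \notin succs s l.
Proof.
move=> hs sub; apply/imsetP => -[a al hE].
have al': a != l by apply: contraTneq al => ->; rewrite inE e_irr.
by have := next_head hs (sub a al) al'; rewrite -hE eqxx.
Qed.

Lemma stuck_last h s l z :
  simple_path h s l -> stuck h s z -> z \notin s -> ~~ e l z.
Proof.
move=> hs st zs; apply/negP => lz; apply: (st _ _ (simple_path_rcons hs zs lz)).
by rewrite perm_rcons.
Qed.

(** Each successor of a neighbour of l is the end of a path on the same
    vertices and with the same start, so an edge to z would enlarge it. *)
Lemma stuck_succs h s l z y :
    simple_path h s l -> stuck h s z -> {subset N l <= s} -> z \notin s ->
  y \in succs s l -> ~~ e z y.
Proof.
move=> hs st sub zs /imsetP[a al ->]; rewrite e_sym.
have as_ := sub _ al; rewrite inE in al.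
have [s' [pe hs']] := simple_path_pivot hs al as_.
apply: (stuck_last hs'); last by rewrite (perm_mem pe).
move=> s2 l2 hs2 p2; apply: st hs2 _.
by rewrite (perm_trans p2) // perm_cons.
Qed.

(** Rotating at a neighbour of l other than its predecessor moves the end. *)
Lemma other_end h s l :
    simple_path h s l -> {subset N l <= s} -> 1 < degree e l ->
  exists s' l', [/\ perm_eq s' s, simple_path h s' l' & l' != l].
Proof.
move=> hs sub dl; have /and4P[_ us _ _] := hs.
have /card_gt0P[a]: 0 < #|N l :\ prev s l|.
  have := cardsD1 (prev s l) (N l); rewrite /degree in dl *.
  rewrite -/(N l) in dl; lia.
rewrite !inE => /andP[ap la].
have as_ : a \in s by apply: sub; rewrite inE.
have [s' [pe hs']] := simple_path_pivot hs la as_.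
exists s', (next s a); split=> //.
by apply: contraNneq ap => <-; rewrite prev_next.
Qed.

(** If the end has low degree, it is x, and a rotation moves the end away from
    x. *)
Lemma good_end k x h s l :
    (forall u, u != x -> k <= degree e u) ->
    (l = x -> k <= degree e x \/ 1 < degree e x) ->
    simple_path h s l -> {subset N l <= s} ->
  exists s' l', [/\ perm_eq s' s, simple_path h s' l' & k <= degree e l'].
Proof.
move=> low lx hs sub; have [dl|dl] := leqP k (degree e l); first by exists s, l.
have lE: l = x by apply/eqP; apply: contraLR dl; rewrite -leqNgt; apply: low.
have [|d1] := lx lE; first by rewrite -lE leqNgt dl.
rewrite -lE in d1; have [s' [l' [pe hs' l'l]]] := other_end hs sub d1.
by exists s', l'; split=> //; apply: low; rewrite -lE.
Qed.

Lemma exists_longest (Q : pred (seq T)) h s l : simple_path h s l -> Q s ->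
  exists h0 s0 l0, [/\ simple_path h0 s0 l0, Q s0 & forall h' s' l',
    simple_path h' s' l' -> Q s' -> size s' <= size s0].
Proof.
move=> hs Qs.
pose P m := [exists p : m.-tuple T,
  [&& Q p, (0 < size p), sorted e p & uniq p]].
have Pm h' s' l' : simple_path h' s' l' -> Q s' -> P (size s').
  move=> hs' Qs'; apply/existsP; exists (in_tuple s') => /=.
  by rewrite Qs'; case/and4P: hs' => -> ->; case: (s').
have exP : exists m, P m by exists (size s); apply: Pm hs Qs.
have bP m : P m -> m <= n.
  case/existsP=> p /and4P[_ _ _ /card_uniqP up].
  by rewrite -(size_tuple p) -up max_card.
case: (ex_maxnP exP bP) => m /existsP[[p /= /eqP<-] /= /and4P[Qp p0 sp up]] mx.
case: p p0 Qp sp up mx => // c p _ Qp sp up mx.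
exists c, (c :: p), (last c p); split=> //.
  by apply/and4P; split=> /=.
by move=> h' s' l' hs' Qs'; apply/mx/(Pm h' s' l').
Qed.


Section Maximal.

Variables (h l : T) (s : seq T).
Hypotheses (hs : simple_path h s l) (mx : maximal s).

Let us : uniq s. Proof. by case/and4P: hs. Qed.

Lemma maximal_stuck z : z \notin s -> stuck h s z.
Proof. by move=> zs s' l' hs'; apply: mx hs'. Qed.

Lemma maximal_nbr : {subset N l <= s}.
Proof.
move=> y; rewrite inE; apply: contraLR => ys.
exact: stuck_last hs (maximal_stuck ys) ys.
Qed.

Lemma maximal_perm s' : perm_eq s' s -> maximal s'.
Proof.
move=> pe h' s2 l' z zs hs2 p2; apply: (mx (z := z) _ hs2).
  by rewrite -(perm_mem pe).
by rewrite (perm_trans p2) // perm_cons.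
Qed.

Lemma maximal_rev : maximal (rev s).
Proof. by apply: maximal_perm; rewrite perm_rev. Qed.

End Maximal.

(** * A vertex missed by a maximal path *)

Section Missing.

Variables (h l : T) (s : seq T) (z : T).
Hypotheses (hs : simple_path h s l) (mx : maximal s) (zs : z \notin s).

Let us : uniq s. Proof. by case/and4P: hs. Qed.
Let Nl : {subset N l <= s}. Proof. exact: maximal_nbr hs mx. Qed.
Let Nh : {subset N h <= s}.
Proof.
by move=> y /(maximal_nbr (simple_path_rev hs) (maximal_rev mx));
  rewrite mem_rev.
Qed.

(** A common vertex would, after a rotation, close the path into a cycle. *)
Lemma disjoint_succs : [disjoint N h & succs s l].
Proof.
apply/pred0P => y /=; apply/negP => /andP[+ /imsetP[a la yE]].
rewrite inE e_sym yE; apply/negP; have as_ := Nl la; rewrite inE in la.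
have [s' [pe hs']] := simple_path_pivot hs la as_.
by apply: (maximal_open hs' (maximal_perm mx pe) (z := z));
  rewrite (perm_mem pe).
Qed.

(** With the neighbours of h and the successors of the neighbours of l, these
    vertices partition s without h. *)
Definition gaps := [set y in s | [&& y != h, ~~ e h y & y \notin succs s l]].

Lemma card_gaps : #|gaps| + degree e h + degree e l + 1 = size s.
Proof.
have <-: #|[set y in s]| = size s by rewrite cardsE; apply/card_uniqP.
rewrite -(card_succs l us) (cardsD1 h [set y in s]) inE.
have /andP[-> _] := simple_path_mem hs; rewrite addnC; congr addn.
have := disjoint_succs; rewrite -leq_card_setU => /eqP E.
rewrite -addnA -E -(cardsID gaps ([set y in s] :\ h)); congr addn.
  apply: eq_card => y; rewrite !inE.
  by case: (y \in s); rewrite ?andbF //= andbT; case: (y == h).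
apply: eq_card => y; rewrite !inE.
have hN: h \notin succs s l by apply: head_succs hs Nl.
have [->|yh] := eqVneq y h; first by rewrite e_irr (negbTE hN) andbF.
case: (boolP (y \in s)) => [_|ys] /=; first by case: (e h y); case: (y \in _).
have ->: e h y = false by apply: contraNF ys => hy; apply: Nh; rewrite inE.
have ->: (y \in succs s l) = false; last by [].
by apply: contraNF ys; apply: succs_sub.
Qed.

Lemma missing_nbr_head a : e z a -> a \in s -> e h a \/ a \in gaps.
Proof.
move=> za as_.
have ah: a != h.
  apply: contraTneq za => ->; rewrite e_sym.
  have zs': z \notin rev s by rewrite mem_rev.
  exact: stuck_last (simple_path_rev hs) (maximal_stuck (maximal_rev mx) zs')
    zs'.
have aS: a \notin succs s l.
  by apply: contraL za; apply: stuck_succs hs (maximal_stuck mx zs) Nl zs.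
by rewrite inE as_ ah aS andbT /=; case: (e h a); [left | right].
Qed.

(** If h is adjacent to the successor of a, there is a path from z to l through
    all of s; so this successor is a gap or comes from a neighbour of l. *)
Lemma missing_nbr_last a :
  e z a -> a \in s -> e l a \/ (a != l) && (next s a \in gaps).
Proof.
move=> za as_.
have al: a != l.
  apply: contraTneq za => ->; rewrite e_sym.
  exact: stuck_last hs (maximal_stuck mx zs) zs.
rewrite al inE mem_next as_ (next_head hs as_ al) /=.
have -> /=: ~~ e h (next s a).
  apply/negP => hb; have [s' [pe hs']] := simple_path_splice hs zs za as_ al hb.
  exact: mx hs' pe.
have [/imsetP[b bl]|] := boolP (_ \in succs s l); last by right.
move/(can_inj (prev_next us)) => ->; left; by rewrite inE in bl.
Qed.

Lemma missing_nbr_next a :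
  e z a -> a \in s -> a != l -> ~~ e z (next s a).
Proof.
move=> za as_ al; apply/negP => zb.
have [s' [pe hs']] := simple_path_insert hs zs za as_ al zb.
exact: mx hs' pe.
Qed.

(** The neighbours of z, the vertices far from l, the set {z, h} and the
    successors of the neighbours of l are disjoint. Their sizes add up to at
    most n, while [card_far] bounds the second from below in terms of deg l,
    which cancels. *)
Lemma far_contradiction k :
    k <= degree e z -> dist_even e l <= k + 1 ->
    (forall a, e z a -> a \notin far l) -> z \notin far l -> h \notin far l ->
  False.
Proof.
move=> kz kl Nz zl hl.
have hS: h \notin succs s l by apply: head_succs hs Nl.
have hin: h \in s by case/andP: (simple_path_mem hs).
have zS: z \notin h |: succs s l.
  rewrite in_setU1 negb_or; apply/andP; split.
    by apply: contraNneq zs => ->.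
  by apply: contraNN zs; apply: succs_sub.
have c1: #|N z :|: far l| = degree e z + #|far l|.
  apply/eqP; rewrite leq_card_setU; apply/pred0P => a /=.
  by rewrite inE; apply/negbTE/negP => /andP[/Nz/negP].
have c2: #|z |: (h |: succs s l)| = 2 + degree e l.
  by rewrite !cardsU1 zS hS card_succs.
have zh: ~~ e z h.
  have zs': z \notin rev s by rewrite mem_rev.
  rewrite e_sym.
  exact: stuck_last (simple_path_rev hs) (maximal_stuck (maximal_rev mx) zs')
    zs'.
have: [disjoint N z :|: far l & z |: (h |: succs s l)].
  rewrite disjoint_sym; apply: disjoint_notin => y.
  rewrite in_setU1 => /orP[/eqP->|]; first by rewrite in_setU negb_or inE e_irr.
  rewrite in_setU1 => /orP[/eqP->|yS]; first by rewrite in_setU negb_or inE zh.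
  rewrite in_setU negb_or inE.
  rewrite (stuck_succs hs (maximal_stuck mx zs) Nl zs yS) /=.
  have /imsetP[a la ->] := yS; have as_ := Nl la; rewrite inE in la.
  rewrite inE; apply/negP => /andP[o /negP]; apply.
  apply: (odd_dist_step2 o la); apply: next_edge hs as_ _.
  by apply: contraTneq la => ->; rewrite e_irr.
rewrite -leq_card_setU => /eqP c3.
have := max_card (mem ((N z :|: far l) :|: (z |: (h |: succs s l)))).
rewrite c3 c1 c2; have := card_far l; rewrite /n; lia.
Qed.

End Missing.

(** A neighbour of y that fails to be adjacent to both ends lies outside s, or
    is a gap, or is followed by a gap. The last two kinds use different gaps,
    because y is not adjacent to consecutive vertices; so there are at most
    (n - |s| - 1) + (|s| - 1 - deg h - deg l) <= n - 2 - 2k failures. *)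
Lemma missing_good_nbr h l s k y :
    simple_path h s l -> maximal s -> y \notin s ->
    k <= degree e h -> k <= degree e l -> n <= 2 * k + 1 + degree e y ->
  exists a, [/\ a \in s, e y a, e h a & e l a].
Proof.
move=> hs mx ys kh kl ky.
have [a /and4P[]|no] := pickP (fun a => [&& a \in s, e y a, e h a & e l a]).
  by exists a.
have us: uniq s by case/and4P: hs.
have [S SE cS] := seq_set us.
have [G GE]: {G : {set T} | G = gaps h l s} by exists (gaps h l s).
(* B1: neighbours that are gaps; B2: neighbours followed by a gap. *)
pose B1 := N y :&: G.
pose B2 := [set a in N y :&: S | (a != l) && (next s a \in G)].
have sub: N y \subset (~: S :\ y) :|: (B1 :|: B2).
  apply/subsetP => a; rewrite in_set => ya.
  rewrite !in_setU !in_set SE ya; case: (boolP (a \in s)) => as_ /=; last first.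
    by rewrite andbT in_set1; have ->: a != y by apply: contraTneq ya => ->;
      rewrite e_irr.
  have := no a; rewrite as_ ya /= andbF /=.
  have [->|] := missing_nbr_head hs mx ys ya as_; last by rewrite -GE => ->.
  have [->//|] := missing_nbr_last hs mx ys ya as_.
  by rewrite -GE => ->; rewrite orbT.
have inj: #|[set next s a | a in B2]| = #|B2|.
  exact/card_imset/can_inj/prev_next.
have dis: [disjoint B1 & [set next s a | a in B2]].
  rewrite disjoint_sym; apply: disjoint_notin => b /imsetP[a + ->].
  rewrite !in_set SE => /andP[/andP[ya as_] /andP[al _]].
  by rewrite (negbTE (missing_nbr_next hs mx ys ya as_ al)).
have subG: B1 :|: [set next s a | a in B2] \subset G.
  apply/subsetP => b /setUP[/setIP[]//|/imsetP[a + ->]].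
  by rewrite inE => /and3P[].
have := subset_leq_card subG; move: dis; rewrite -leq_card_setU => /eqP->.
rewrite inj => leG.
have := subset_leq_card sub => le1.
have := leq_card_setU (~: S :\ y) (B1 :|: B2).
have := leq_card_setU B1 B2 => -[le2 _] [le3 _].
have := card_gaps hs mx ys; rewrite -GE => cG.
have := cardsD1 y (~: S); rewrite in_setC SE ys => cD.
have cC: #|S| + #|~: S| = n := cardsC S.
have dN: #|N y| = degree e y by [].
rewrite dN in le1; exfalso; lia.
Qed.

(** There is at most one gap. If all neighbours of z on s are adjacent to l,
    none of them is far from l. Otherwise one of them, a, is followed by the
    gap; another neighbour not adjacent to h would be that gap, hence the
    successor of a. So all of them are adjacent to h, and the reversed path is
    used. *)
Lemma maximal_spans h l s k :
    simple_path h s l -> maximal s ->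
    k <= degree e h -> k <= degree e l ->
    (forall y, y \notin s -> k <= degree e y) ->
    (forall y, dist_even e y <= k + 1) ->
    n <= 2 * k + 3 -> (forall y, n <= 2 * k + 1 + degree e y) ->
  forall z, z \in s.
Proof.
move=> hs mx kh kl kmiss ev n3 deg z; apply/negPn/negP => zs.
have us: uniq s by case/and4P: hs.
have good y : y \notin s -> exists a, [/\ a \in s, e y a, e h a & e l a].
  by move=> ys; apply: missing_good_nbr hs mx ys kh kl (deg y).
have notfar u w a : e u a -> e a w -> w \notin far u.
  by move=> ua aw; rewrite inE; apply/negP => /andP[o /negP]; apply;
     apply: odd_dist_step2 o ua aw.
have gap1: #|gaps h l s| <= 1.
  have := card_gaps hs mx zs.
  have [S SE cS] := seq_set us.
  have cC: #|S| + #|~: S| = n := cardsC S.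
  have : 0 < #|~: S| by apply/card_gt0P; exists z; rewrite in_setC SE.
  lia.
have [z0 [z0s zz0 hz0 lz0]] := good z zs.
have [/existsP[a /and3P[as_ za la]]|all] :=
    boolP [exists a, [&& a \in s, e z a & ~~ e l a]].
  have zs' : z \notin rev s by rewrite mem_rev.
  apply: (far_contradiction (simple_path_rev hs) (maximal_rev mx) zs' (kmiss z
    zs) (ev h)).
  - move=> b zb; have [bs|bs] := boolP (b \in s); last first.
      have [c [_ bc hc _]] := good b bs.
      by apply: notfar hc _; rewrite e_sym.
    have [hb|bG] := missing_nbr_head hs mx zs zb bs;
      first by rewrite inE hb andbF.
    have [la'|/andP[al aG]] := missing_nbr_last hs mx zs za as_.
      by rewrite la' in la.
    have bE: b = next s a.
      by move/card_le1_eqP: gap1 => /(_ _ _ bG aG) ->.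
    by move: (missing_nbr_next hs mx zs za as_ al); rewrite -bE zb.
  - by apply: notfar hz0 _; rewrite e_sym.
  by apply: notfar hz0 _; rewrite e_sym.
apply: (far_contradiction hs mx zs (kmiss z zs) (ev l)).
- move=> b zb; have [bs|bs] := boolP (b \in s); last first.
    have [c [_ bc _ lc]] := good b bs.
    by apply: notfar lc _; rewrite e_sym.
  rewrite inE; move: all; rewrite negb_exists => /forallP/(_ b).
  by rewrite bs zb /= negbK => ->; rewrite andbF.
- by apply: notfar lz0 _; rewrite e_sym.
by apply: notfar lz0 _; rewrite e_sym.
Qed.

(** * Cut vertices *)

Definition separation v (A B : {set T}) :=
  [/\ v \notin A, B = ~: (v |: A), A != set0, B != set0
    & {in A & B, forall a b, ~~ e a b}].

Lemma separation_sym v A B : separation v A B -> separation v B A.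
Proof.
case=> vA BE A0 B0 AB; have AE: A = ~: (v |: B).
  apply/setP => y; rewrite BE !inE negb_or negbK.
  by have [->|] := eqVneq y v; rewrite ?(negbTE vA).
split=> //; first by rewrite BE !inE eqxx.
by move=> b a bB aA; rewrite e_sym AB.
Qed.

Lemma separation_nbr v A B : separation v A B -> exists2 u, u \in A & e v u.
Proof.
case=> vA BE /set0Pn[a aA] _ AB.
have [u [b [uA bA ub]]] := @edge_out (fun y => y \in A) _ _ aA vA;
  exists u => //.
have : b \notin B by apply: contraL ub => bB; apply: AB.
by rewrite BE !inE (negbTE bA) orbF negbK => /eqP <-; rewrite e_sym.
Qed.

Lemma separation_closed v A B a y :
  separation v A B -> a \in A -> e a y -> y \in v |: A.
Proof.
case=> _ BE _ _ AB aA ay; have : y \notin B by apply: contraL ay; apply: AB.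
by rewrite BE inE negbK.
Qed.

Lemma dist_id v : dist e v v = 0.
Proof. by apply/eqP; rewrite -leqn0; apply: (@dist_le v [::]). Qed.

(** Every path from A to B passes through v. *)
Lemma separation_dist v A B u b :
  separation v A B -> u \in A -> e v u -> b \in B ->
    dist e u b = (dist e v b).+1.
Proof.
move=> sep uA vu bB; apply/eqP; rewrite eqn_leq; apply/andP; split.
  have [p [vp <- <-]] := dist_path v b.
  by have /dist_le : path e u (v :: p) by rewrite /= e_sym vu.
have [p [up lb <-]] := dist_path u b.
have vp: v \in p.
  have [vA BE _ _ AB] := sep.
  elim: p u uA up lb {vu} => [|c p IH] u uA /= => [_ E|/andP[uc cp] lb].
    by move: bB; rewrite -E BE !inE uA orbT.
  rewrite inE; have := separation_closed sep uA uc.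
  rewrite !inE => /orP[/eqP->|cA]; first by rewrite eqxx.
  by rewrite (IH c) ?orbT.
case/splitPr: vp up lb => p1 p2;
  rewrite cat_path last_cat /= => /and3P[_ _ vp2] lb.
by have := dist_le vp2; rewrite lb size_cat /=; lia.
Qed.

Definition odd_part v (B : {set T}) := [set b in B | odd (dist e v b)].

(** Vertices of B at odd distance from v are at even distance from u. *)
Lemma odd_part_bound v A B u (C : {set T}) :
    separation v A B -> u \in A -> e v u ->
    C \subset A -> {in C, forall w, ~~ odd (dist e u w)} ->
  #|C| + #|odd_part v B| <= dist_even e u.
Proof.
move=> sep uA vu CA Cev.
have dis: [disjoint C & odd_part v B].
  apply: disjoint_notin => y /(subsetP CA) yA; rewrite !inE.
  by have [_ -> _ _ _] := sep; rewrite !inE yA orbT.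
move: dis; rewrite -leq_card_setU => /eqP <-.
apply/subset_leq_card/subsetP => y; rewrite !inE => /orP[/Cev//|/andP[yB]].
by rewrite (separation_dist sep uA vu yB) /= => ->.
Qed.

Lemma even_parts_bound v A B : separation v A B ->
  #|A :\: odd_part v A| + #|B :\: odd_part v B| + 1 <= dist_even e v.
Proof.
move=> sep; have [vA BE _ _ _] := sep.
set X := A :\: _; set Y := B :\: _.
have dis: [disjoint X & Y].
  apply: disjoint_notin => y; rewrite /X /Y !inE => /andP[_ yA].
  by rewrite BE !inE yA orbT andbF.
have vX: v \notin X :|: Y by rewrite /X /Y BE !inE eqxx (negbTE vA) !andbF.
move: dis; rewrite -leq_card_setU => /eqP <-.
have := cardsU1 v (X :|: Y); rewrite vX addnC => <-.
apply/subset_leq_card/subsetP => y; rewrite /X /Y !inE => /orP[/eqP->|].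
  by rewrite dist_id.
by case/orP=> /andP[]; rewrite negb_and => /orP[/negP|].
Qed.

Lemma path_inside v A B y p : separation v A B ->
  path e y p -> v \notin y :: p -> last y p \in A -> {subset y :: p <= A}.
Proof.
move=> sep; elim: p y => [|c p IH] y /=;
  first by move=> _ _ yA w /[!inE] /eqP->.
case/andP=> yc cp; rewrite inE negb_or => /andP[vy vp] lA.
have sub := IH _ cp vp lA; have cA := sub c (mem_head _ _).
move=> w; rewrite inE => /orP[/eqP->|]; last exact: sub.
have := separation_closed sep cA; rewrite e_sym in yc => /(_ _ yc).
by rewrite !inE eq_sym (negbTE vy).
Qed.

Lemma stuck_nbr v A B s l :
    separation v A B -> simple_path v s l -> {subset s <= v |: A} ->
    (forall z, z \in A -> z \notin s -> stuck v s z) ->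
  l \in A /\ {subset N l <= s}.
Proof.
move=> sep hs sub st; have [vA _ _ _ _] := sep.
have /andP[vs ls] := simple_path_mem hs.
have lA: l \in A.
  have := sub l ls; rewrite !inE => /orP[/eqP lv|//].
  have [u uA vu] := separation_nbr sep.
  have sE: s =i [:: v].
    move: hs => /and4P[_]; case: s {sub st vs ls} => // c p.
    rewrite -[ohead _]/(Some c) => uc /eqP[cv]; move: uc; rewrite lv cv /=.
    case: p => [|d p] //= /andP[/negP vp _] /eqP vl.
    case: vp; by rewrite -{1}vl mem_last.
  have us: u \notin s by rewrite sE inE; apply: contraNneq vA => <-.
  by have := stuck_last hs (st u uA us) us; rewrite lv vu.
split=> // y; rewrite inE => ly; have := separation_closed sep lA ly.
rewrite !inE => /orP[/eqP->//|yA]; apply: contraLR ly => ys.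
exact: stuck_last hs (st y yA ys) ys.
Qed.

(** In v + A take a longest path that starts at v and, if x is in A, passes
    through x, and rotate its end l to a vertex of degree at least k. Let z in
    A be missed and E be the set of successors of the neighbours of l. Since z,
    E and the neighbours of z are disjoint in v + A, |A| >= 2k. Parity gives
    |A| <= 2k, and equality makes z adjacent to v and puts all of B at odd
    distance from v, hence at even distance from z. So fewer than k vertices of
    E can be at even distance from z, and E contains vertices far from z. Such
    a vertex w shares no neighbour with z, so deg w < k and w = x. Being the
    only one, it leaves room for a single vertex in B, whose degree then bounds
    k by 1. But x, being of degree less than k, has degree at least 2. *)
Lemma separation_path k x v A B :
    separation v A B ->
    (forall u, u != x -> k <= degree e u) ->
    (forall u, dist_even e u <= k + 1) ->
    (x \in A -> k <= degree e x \/ 1 < degree e x) ->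
  exists s l, simple_path v s l /\ s =i v |: A.
Proof.
move=> sep low ev lx; have [vA BE _ _ _] := sep.
have sepC := separation_sym sep.
pose Q s := [&& ohead s == Some v, (x \in A) ==> (x \in s)
  & all (fun y => y \in v |: A) s].
have [h0 [s0 [l0 [hs0 Qs0]]]] : exists h s l, simple_path h s l /\ Q s.
  have [xA|xA] := boolP (x \in A); last first.
    exists v, [:: v], v; rewrite /simple_path /Q (negbTE xA) /=.
    by rewrite !inE !eqxx.
  have /connectP[p0 vp0 xE] := e_conn v x.
  case/shortenP: vp0 xE => p vp up _ xE.
  exists v, (v :: p), x; split; first by apply/and4P; split=> //=; rewrite -xE.
  apply/and3P; split=> //=; first by apply/implyP => _; rewrite xE mem_last.
  rewrite !inE eqxx /=; apply/allP=> w wp; rewrite !inE; apply/orP; right.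
  case: p vp up xE wp => // c p /= /andP[_ cp] /andP[vcp _] xE wp.
  by apply: (path_inside sep cp vcp _ wp); rewrite -xE.
have [h [s1 [l1 [hs1 Qs1 mx1]]]] := exists_longest hs0 Qs0.
have hv: h = v.
  by case/and4P: hs1 => _ _ /eqP E _; case/and3P: Qs1 => /eqP; rewrite E => -[].
rewrite {h}hv in hs1.
have st1 z : z \in A -> z \notin s1 -> stuck v s1 z.
  move=> zA zs s' l' hs' pe; have := mx1 _ _ _ hs'; rewrite (perm_size pe) /=.
  rewrite ltnn => nQ; have Qs': Q s'; last by have := nQ Qs'.
  clear nQ.
  case/and3P: Qs1 => _ xs1 al1; rewrite /Q (perm_all _ pe) (perm_mem pe) /= al1.
  rewrite !inE zA orbT andbT; case/and4P: hs' => _ _ -> _ /=.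
  rewrite andbT; apply/implyP => xA; by rewrite (implyP xs1 xA) orbT.
have vs1: v \in s1 by case/andP: (simple_path_mem hs1).
have sub1: {subset s1 <= v |: A} by case/and3P: Qs1 => _ _ /allP.
have xs1: x \in A -> x \in s1 by case/and3P: Qs1 => _ /implyP.
have [l1A Nl1] := stuck_nbr sep hs1 sub1 st1.
have xl: l1 = x -> k <= degree e x \/ 1 < degree e x.
  by move=> lE; apply: lx; rewrite -lE.
have [s [l [pe hs dl]]] := good_end low xl hs1 Nl1.
exists s, l; split=> // y; rewrite (perm_mem pe).
apply/idP/idP => [|]; first exact: sub1.
rewrite !inE => /orP[/eqP->//|yA]; apply/negPn/negP => ys1.
have {ys1 yA} [z [zA zs]] : exists z, z \in A /\ z \notin s.
  by exists y; rewrite (perm_mem pe).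
have sub: {subset s <= v |: A} by move=> w; rewrite (perm_mem pe); apply: sub1.
have st w : w \in A -> w \notin s -> stuck v s w.
  move=> wA ws s' l' hs' p'; apply: (st1 w wA _ s' l' hs').
    by rewrite -(perm_mem pe).
  by rewrite (perm_trans p') // perm_cons.
have [lA Nl] := stuck_nbr sep hs sub st.
have zx: z != x.
  by apply: contraNneq zs => zE; rewrite (perm_mem pe) zE xs1 // -zE.
have us: uniq s by case/and4P: hs.
pose E := succs s l.
have cE: #|E| = degree e l := card_succs l us.
have EA: E \subset A.
  apply/subsetP => w wE; have := sub w (succs_sub Nl wE).
  rewrite !inE => /orP[/eqP wv|//].
  by have := head_succs hs Nl; rewrite -wv wE.
have zE: z \notin E by apply: contraNN zs; apply: succs_sub.
have Nz: {in E, forall w, ~~ e z w}.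
  by move=> w; apply: stuck_succs hs (st z zA zs) Nl zs.
have dis: [disjoint N z & z |: E].
  rewrite disjoint_sym; apply: disjoint_notin => w.
  by rewrite !inE => /orP[/eqP->|/Nz //]; rewrite e_irr.
have NzS: N z \subset v |: A.
  by apply/subsetP => w; rewrite inE; apply: separation_closed sep zA.
have zES: z |: E \subset v |: A.
  apply/subsetP => w; rewrite !inE => /orP[/eqP->|/(subsetP EA)->].
    by rewrite zA orbT.
  by rewrite orbT.
have c1: #|N z :|: (z |: E)| = degree e z + (1 + degree e l).
  move: dis; rewrite -leq_card_setU => /eqP->; congr addn.
  by rewrite cardsU1 zE cE.
have cvA: #|v |: A| = 1 + #|A| by rewrite cardsU1 vA.
have dz := low z zx.
(* Applied to both orders of the parts, with a neighbour of v in the other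
   one. *)
have oB_k C D : separation v C D -> #|odd_part v D| <= k.
  move=> sepCD; have [u uC vu] := separation_nbr sepCD.
  have := @odd_part_bound v C D u [set u] sepCD uC vu.
  rewrite sub1set uC cards1 => /(_ isT) H; have := ev u.
  have: 1 + #|odd_part v D| <= dist_even e u; last first.
    by move=> oD evu; rewrite -(leq_add2l 1) [1 + k]addnC (leq_trans oD).
  by apply: H => w; rewrite inE => /eqP->; rewrite dist_id.
have oBk := oB_k _ _ sep; have oAk := oB_k _ _ sepC.
have eAB := leq_trans (even_parts_bound sep) (ev v).
have cA := cardsID (odd_part v A) A; have cB := cardsID (odd_part v B) B.
have subI (C : {set T}) : C :&: odd_part v C = odd_part v C.
  by apply/setIidPr/subsetP => w; rewrite inE => /andP[].
rewrite !subI in cA cB.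
have c2: degree e z + (1 + degree e l) <= 1 + #|A|.
  by rewrite -c1 -cvA subset_leq_card // subUset NzS.
have A2k: #|A| = 2 * k by move: c2 dz dl oAk eAB cA; clear; lia.
have oBE: #|B| = #|odd_part v B|.
  by move: oAk eAB cA cB A2k; clear; lia.
(* Otherwise 2k + 1 vertices have to fit in A. *)
have vz: e z v.
  apply: contraT => zv; have : N z :|: (z |: E) \subset A.
    apply/subsetP => w wX; have : w \in v |: A.
      by apply: subsetP wX; rewrite subUset NzS.
    rewrite in_setU1 => /orP[/eqP wv|//]; move: wX.
    rewrite wv in_setU inE (negbTE zv) in_setU1 /= => /orP[/eqP->|vE].
      exact: zA.
    exact: (subsetP EA).
  by move/subset_leq_card; rewrite c1; move: dz dl A2k; clear; lia.
have vz' : e v z by rewrite e_sym.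
(* The closed neighbourhoods of z and w are disjoint in the 2k + 1 vertices of
   v + A. *)
have farE w : w \in E :&: far z -> degree e w < k.
  rewrite inE => /andP[wE]; rewrite inE => /andP[ow zw].
  have d1: [disjoint N z & N w].
    apply: disjoint_notin => a; rewrite !inE => za; rewrite e_sym.
    by apply: contraNN zw; apply: odd_dist_step2.
  have NwS: N w \subset v |: A.
    apply/subsetP => a; rewrite inE.
    by apply: separation_closed sep _; apply: (subsetP EA).
  have zw': z != w by apply: contraNneq zE => ->.
  have d2: [disjoint N z :|: N w & [set z; w]].
    rewrite disjoint_sym; apply: disjoint_notin => a.
    move=> /set2P[]->; rewrite in_setU !in_set e_irr ?(negbTE zw) //.
    by rewrite e_sym (negbTE zw).
  have : (N z :|: N w) :|: [set z; w] \subset v |: A.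
    rewrite !subUset NzS NwS !sub1set !inE zA (subsetP EA _ wE) !orbT //.
  move/subset_leq_card; move: d2 d1; rewrite -!leq_card_setU => /eqP-> /eqP->.
  rewrite cards2 zw' cvA -[#|N z|]/(degree e z) -[#|N w|]/(degree e w).
  by move: dz A2k; clear; lia.
(* Of the vertices of E, only those far from z are at odd distance from z. *)
have c3 : 1 + #|E :\: far z| + #|odd_part v B| <= k + 1.
  have zX: z \notin E :\: far z by rewrite inE (negbTE zE) andbF.
  have := cardsU1 z (E :\: far z); rewrite zX => <-.
  apply: leq_trans (ev z); apply: (odd_part_bound sep zA vz').
    apply/subsetP => w; rewrite !inE => /orP[/eqP->//|/andP[_]];
      exact: (subsetP EA).
  move=> w; rewrite in_setU1 => /orP[/eqP->|]; first by rewrite dist_id.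
  by rewrite in_setD inE => /andP[+ wE]; rewrite (Nz w wE) andbT.
have c4 := cardsID (far z) E.
have farx w : w \in E :&: far z -> w = x.
  by move=> /farE dw; apply/eqP; apply: contraLR dw; rewrite -leqNgt;
    apply: low.
have c5: #|E :&: far z| <= 1.
  by apply/card_le1_eqP => a b /farx-> /farx->.
have oB1: 0 < #|odd_part v B|.
  have [u uB vu] := separation_nbr sepC; apply/card_gt0P; exists u.
  by rewrite inE uB odd_dist_edge.
have [w wEf] : exists w, w \in E :&: far z 
  by apply/card_gt0P; move: c3 c4 oB1 dl; rewrite cE; clear; lia.
have wx := farx w wEf; have dx := farE w wEf; rewrite wx in dx.
have xA: x \in A.
  by rewrite -wx; apply: (subsetP EA); case/setIP: wEf.
have [|dx1] := lx xA; first by rewrite leqNgt dx.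
have [_ _ _ /set0Pn[b bB] _] := sep.
have bx: b != x.
  by apply: contraTneq bB => ->; rewrite BE !inE xA orbT.
have : N b \subset v |: (B :\ b).
  apply/subsetP => a; rewrite inE => ba; have := separation_closed sepC bB ba.
  rewrite !inE; have [ab|] //= := eqVneq a b; by rewrite ab e_irr in ba.
move/subset_leq_card; rewrite cardsU1; have := cardsD1 b B; rewrite bB.
have := low b bx; rewrite -[#|N b|]/(degree e b).
move: c3 c4 c5 dl dx dx1 oBE; rewrite cE; case: (_ \notin _); clear; lia.
Qed.

Lemma traceable_glue v A B s1 s2 l1 l2 : separation v A B ->
    simple_path v s1 l1 -> s1 =i v |: A -> simple_path v s2 l2 ->
      s2 =i v |: B ->
  traceable e.
Proof.
move=> [vA BE _ _ _] hs1 E1 hs2 E2.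
case/and4P: (simple_path_rev hs1); case: s1 E1 hs1 => [|c p1] E1 hs1.
  by have := E1 v; rewrite !inE eqxx.
case/and4P: hs1 => _ u1 /eqP[cv] _; rewrite cv in E1 u1 * => r1 _ _ _.
case: s2 E2 hs2 => [|d p2] E2; first by have := E2 v; rewrite !inE eqxx.
case/and4P=> r2 u2 /eqP[dv] _; rewrite dv in E2 u2 r2.
have vp1: v \notin p1 by case/andP: u1.
have [vp2 up2]: v \notin p2 /\ uniq p2 by case/andP: u2.
have p1A y : y \in p1 -> y \in A.
  move=> yp; have := E1 y; rewrite !inE yp orbT => /esym/orP[/eqP yv|//].
  by rewrite -yv yp in vp1.
have p2B y : y \in p2 -> y \in B.
  move=> yp; have := E2 y; rewrite !inE yp orbT => /esym/orP[/eqP yv|//].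
  by rewrite -yv yp in vp2.
exists (rev (v :: p1) ++ p2); split.
- case: p2 r2 {E2 u2 vp2 up2 p2B} => [|b p2]; first by rewrite cats0.
  by move: r1; rewrite rev_cons sorted_catE => -> /= ->.
- rewrite cat_uniq rev_uniq u1 up2 andbT.
  apply/hasPn => y yp; rewrite mem_rev inE negb_or (contraNneq _ vp2) /=.
    by have := p2B y yp; rewrite BE !inE negb_or => /andP[_]; apply: contraNN;
      apply: p1A.
  by move=> <-.
move=> y; rewrite mem_cat mem_rev E1; have [//|yA] := boolP (y \in v |: A).
have yB: y \in B by rewrite BE inE.
have := E2 y; rewrite !inE yB orbT => /orP[/eqP yv|//].
by rewrite yv !inE eqxx in yA.
Qed.

Lemma separation_traceable k x v A B :
    separation v A B ->
    (forall u, u != x -> k <= degree e u) ->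
    (forall u, dist_even e u <= k + 1) ->
    k <= degree e x \/ 1 < degree e x ->
  traceable e.
Proof.
move=> sep low ev lx.
have [s1 [l1 [hs1 E1]]] := separation_path sep low ev (fun _ => lx).
have [s2 [l2 [hs2 E2]]] :=
  separation_path (separation_sym sep) low ev (fun _ => lx).
exact: traceable_glue sep hs1 E1 hs2 E2.
Qed.

(** The neighbour v of x separates x from the other vertices, all of which have
    degree at least k, so that [separation_path] applies to them. *)
Lemma leaf_traceable k x :
    (forall u, u != x -> k <= degree e u) ->
    (forall u, dist_even e u <= k + 1) ->
    degree e x = 1 -> 1 < k ->
  traceable e.
Proof.
move=> low ev /eqP/cards1P[v Nx] k1.
have xv: e x v by have := set11 v; rewrite -Nx inE.
have vx: v != x by apply: contraTneq xv => ->; rewrite e_irr.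
have Nx' y : e x y = (y == v) by have := in_set1 y v; rewrite -Nx inE.
have sep: separation v [set x] (~: [set v; x]).
  split=> //; first by rewrite inE.
  - by apply/set0Pn; exists x; rewrite inE.
  - have : 0 < #|N v :\ x|.
      have := cardsD1 x (N v); have := low v vx.
      by rewrite /degree -/(N v); case: (_ \in _); lia.
    case/card_gt0P=> y; rewrite !inE => /andP[yx vy]; apply/set0Pn; exists y.
    rewrite !inE negb_or yx andbT; apply: contraTneq vy => ->.
    by rewrite e_irr.
  by move=> a b /set1P-> ; rewrite !inE negb_or Nx' => /andP[].
have [s [l [hs E]]] : exists s l, simple_path v s l /\ s =i v |: ~: [set v; x].
  apply: (separation_path (separation_sym sep) low ev).
  by rewrite !inE eqxx orbT.
have hx: simple_path v [:: v; x] x.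
  apply/and4P; split=> //=; first by rewrite e_sym xv.
  by rewrite inE vx.
have Ex: [:: v; x] =i v |: [set x] by move=> y; rewrite !inE.
exact: traceable_glue sep hx Ex hs E.
Qed.

Lemma not_two_connected_separation :
  2 < n -> ~ two_connected e -> exists v A B, separation v A B.
Proof.
move=> n2 no2; pose r v := [rel a b in predC1 v | e a b].
have [/existsP[v /existsP[a /existsP[b /and3P[av bv nab]]]]|all] := boolP
    [exists v, exists a, exists b, [&& a != v, b != v & ~~ connect (r v) a b]].
  exists v, [set y | connect (r v) a y & y != v].
  exists (~: (v |: [set y | connect (r v) a y & y != v])); split=> //.
  - by rewrite inE eqxx andbF.
  - by apply/set0Pn; exists a; rewrite inE connect0.
  - by apply/set0Pn; exists b; rewrite !inE (negbTE nab) negb_or bv.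
  move=> y z; rewrite !inE => /andP[ay yv]; rewrite negb_or => /andP[zv].
  rewrite zv andbT; apply: contraNN => yz.
  by apply: connect_trans ay (connect1 _); rewrite /= !inE yv zv.
case: no2; split=> // v a b av bv; apply: contraNT all => nab.
apply/existsP; exists v; apply/existsP; exists a; apply/existsP; exists b.
by rewrite !inE in av bv; rewrite av bv.
Qed.

(** The only neighbour of a vertex of degree 1 would be a cut vertex. *)
Lemma two_connected_degree y : two_connected e -> 1 < degree e y.
Proof.
case=> n2 _ two; rewrite ltnNge; apply/negP => d1.
have /eqP/cards1P[v Ny] : degree e y = 1.
  by apply/eqP; rewrite eqn_leq d1 degree_gt0 // ltnW.
have Ny' w : e y w = (w == v) by have := in_set1 w v; rewrite -Ny inE.
have yv: y != v by apply/negP => /eqP E; have := Ny' v; rewrite -E e_irr eqxx.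
have /card_gt0P[w] : 0 < #|~: [set v; y]|.
  by have := cardsC [set v; y]; rewrite cards2; case: (_ != _); lia.
rewrite !inE negb_or => /andP[wv wy].
have := two v y w; rewrite !inE => /(_ yv wv) /connectP[[|c p] /=].
  by move=> _ E; rewrite E eqxx in wy.
by rewrite Ny' !inE => /andP[/andP[/andP[_ cv] /eqP E]]; rewrite E eqxx in cv.
Qed.

(** The path is longest among those through x, so that only vertices of degree
    at least k can be missed. Both ends are rotated, one after the other. *)
Lemma exists_maximal_path k x :
    (forall u, u != x -> k <= degree e u) ->
    k <= degree e x \/ 1 < degree e x ->
  exists h s l, [/\ simple_path h s l, maximal s, x \in s,
    k <= degree e h & k <= degree e l].
Proof.
move=> low lx; pose Q (s : seq T) := x \in s.
have hx: simple_path x [:: x] x by rewrite /simple_path /= !eqxx.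
have Qx: Q [:: x] by rewrite /Q inE.
have [h [s [l [hs Qs mx]]]] := exists_longest hx Qx.
have ms: maximal s.
  move=> h' s' l' z zs hs' pe; have := mx _ _ _ hs'.
  by rewrite /Q (perm_mem pe) inE [x \in s]Qs orbT (perm_size pe) /= ltnn =>
    /(_ isT).
have [s1 [l1 [pe1 hs1 d1]]] :=
  good_end low (fun _ => lx) hs (maximal_nbr hs ms).
have hs1' := simple_path_rev hs1.
have ms1 := maximal_rev (maximal_perm ms pe1).
have [s2 [l2 [pe2 hs2 d2]]] :=
  good_end low (fun _ => lx) hs1' (maximal_nbr hs1' ms1).
exists l1, s2, l2; split=> //.
  by apply: maximal_perm pe2.
by rewrite (perm_mem pe2) mem_rev (perm_mem pe1).
Qed.

Lemma spanning_traceable h s l : simple_path h s l -> (forall y, y \in s) ->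
  traceable e.
Proof. by move=> /and4P[ss us _ _] all; exists s. Qed.

(** No vertex is far from v, so its neighbours are all the vertices at odd
    distance. *)
Lemma diam2_degree v k :
  diam e <= 2 -> dist_even e v <= k + 1 -> n <= degree e v + k + 1.
Proof.
move=> d2 ev; have := card_far v.
have ->: far v = set0; last by rewrite cards0; lia.
apply/setP => w; rewrite in_set0 inE; apply/negbTE/negP => /andP[o /negP];
  apply.
apply: odd_dist_le2 o (leq_trans _ d2).
apply: leq_trans (leq_bigmax_cond (F := fun u => \max_w dist e u w) v isT).
exact: (leq_bigmax_cond (F := dist e v) w isT).
Qed.

End Simple.

Theorem theorem2 (T : finType) (e : rel T)
  (e_sym : symmetric e) (e_irr : irreflexive e) (T_nontrivial : 2 <= #|T|)
  (e_conn : connected e)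
  (h_even : \max_(v : T) dist_even e v <= second_degree e + 1)
  (h_cond : [\/ diam e <= 2,
                #|T| <= 2 * second_degree e + 2,
                #|T| = 2 * second_degree e + 3 /\ two_connected e
              | ~ two_connected e]) :
  traceable e.
Proof.
have [x low] := second_degreeP e T_nontrivial.
move: (second_degree e) h_even h_cond low => k h_even h_cond low.
have ev u : dist_even e u <= k + 1.
  exact: leq_trans (leq_bigmax_cond (F := dist_even e) u isT) h_even.
have dpos v : 0 < degree e v by apply: degree_gt0.
have [/andP[d1 k1]|lx] := boolP ((degree e x == 1) && (1 < k)).
  exact: (leaf_traceable e_sym e_irr e_conn low ev (eqP d1) k1).
have {}lx : k <= degree e x \/ 1 < degree e x.
  have [d1|d1] := ltnP 1 (degree e x); [by right | left].
  have dx : degree e x = 1 by apply/eqP; rewrite eqn_leq d1 dpos.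
  by move: lx; rewrite dx eqxx -leqNgt.
have [h [s [l [hs mx xs dh dl]]]] := exists_maximal_path e_sym e_irr low lx.
have miss y : y \notin s -> k <= degree e y.
  by move=> ys; apply: low; apply: contraNneq ys => ->.
have core : #|T| <= 2 * k + 3 -> (forall y, #|T| <= 2 * k + 1 + degree e y) ->
    traceable e.
  move=> n3 nd; apply: (spanning_traceable hs).
  exact: (maximal_spans e_sym e_irr e_conn hs mx dh dl miss ev n3 nd).
case: h_cond => [d2|n2|[n3 two]|no2].
- apply: (spanning_traceable hs) => z; apply/negPn/negP => zs.
  have := card_gaps e_sym e_irr e_conn hs mx zs.
  have := diam2_degree e_irr e_conn d2 (ev h).
  have us : uniq (z :: s) by case/and4P: hs => _ us _ _; rewrite /= zs us.
  have : size s < #|T|.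
    by have := max_card (mem (z :: s)); rewrite (card_uniqP us).
  by move: dl; clear; lia.
- by apply: core => [|y]; [|have := dpos y]; lia.
- by apply: core => [|y];
    [|have := two_connected_degree e_irr e_conn y two]; lia.
have [n2|n2] := leqP #|T| 2.
  by apply: core => [|y]; [|have := dpos y]; lia.
have [v [A [B sep]]] :=
  not_two_connected_separation e_conn n2 no2.
exact: (separation_traceable e_sym e_irr e_conn sep low ev lx).
Qed.
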